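(* Let $n\geqslant 2$, $\lambda>0$, let $p_1,\ldots,p_M\in\mathbb{Z}^n$ be distinct points and $n_1,\ldots,n_M$ positive integers. Consider the self-dual Chern–Simons vortex equation $$\Delta u=\lambda e^u(e^u-1)+4\pi\sum_{j=1}^M n_j\delta_{p_j}\quad\text{on }\mathbb{Z}^n,\qquad \lim_{d(x)\to+\infty}u(x)=0. \qquad (\ast)$$ Then $(\ast)$ has a solution $u$ (a topological solution) with $u\in l^p(\mathbb{Z}^n)$ for every $1\leqslant p\leqslant\infty$, which is maximal among all solutions of $(\ast)$, i.e. $f\leqslant u$ pointwise on $\mathbb{Z}^n$ for every solution $f$ of $(\ast)$. Moreover, setting $m=\ln(1+\frac{\lambda}{2n})$, for every $0<\epsilon<1$ one has $u(x)=O(e^{-m(1-\epsilon)d(x)})$ as $d(x)\to+\infty$, i.e. there is a constant $C(\epsilon)$ with $|u(x)|\leqslant C(\epsilon)e^{-m(1-\epsilon)d(x)}$ for all $x$ with $d(x)$ sufficiently large.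
   Context: $\mathbb{Z}^n$ is the integer lattice graph: vertices are the points of $\mathbb{Z}^n$, and $x\sim y$ iff $\sum_{i=1}^n|x_i-y_i|=1$. The distance is $d(x,y)=\sum_{i=1}^n|x_i-y_i|$ and $d(x)=d(x,0)$. The Laplacian of $u:\mathbb{Z}^n\to\mathbb{R}$ is $\Delta u(x)=\sum_{y:\,d(x,y)=1}(u(y)-u(x))$. $\delta_p$ denotes the function on $\mathbb{Z}^n$ equal to $1$ at $p$ and $0$ elsewhere. $l^p(\mathbb{Z}^n)$ is the space of functions with $\sum_x|u(x)|^p<\infty$ ($1\leqslant p<\infty$), resp. $\sup_x|u(x)|<\infty$ ($p=\infty$). A solution $u$ of the equation with $u(x)\to0$ as $d(x)\to\infty$ is called topological. *)

(* Defs.v *)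
From HB Require Import structures.
From mathcomp Require Import all_boot all_order all_algebra.
From mathcomp Require Import all_classical all_reals all_analysis.
Set Implicit Arguments. Unset Strict Implicit. Unset Printing Implicit Defensive.
Import Order.TTheory GRing.Theory Num.Theory.
Local Open Scope ring_scope.

Definition pt (n : nat) := {ffun 'I_n -> int}.

Definition dnorm (n : nat) (x : pt n) : nat := (\sum_(i < n) `|x i|)%N.

Definition dist (n : nat) (x y : pt n) : nat := (\sum_(i < n) `|x i - y i|)%N.

Definition shift (n : nat) (x : pt n) (i : 'I_n) (s : int) : pt n :=
  [ffun j => if j == i then x j + s else x j].

(* The neighbours of x (points y with d(x,y)=1) are exactly x +- e_i,
   so Delta u(x) = sum_{d(x,y)=1} (u y - u x) unfolds to: *)
Definition lap (R : realType) (n : nat) (u : pt n -> R) (x : pt n) : R :=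
  \sum_(i < n) ((u (shift x i 1) - u x) + (u (shift x i (-1)) - u x)).

Definition delta (R : realType) (n : nat) (p : pt n) (x : pt n) : R :=
  if x == p then 1 else 0.

Definition vanishes_at_infty (R : realType) (n : nat) (u : pt n -> R) : Prop :=
  forall eps : R, 0 < eps -> exists r : nat,
    forall x : pt n, (r <= dnorm x)%N -> `|u x| < eps.

(* u in l^p(Z^n) for real 1 <= p < oo: sum_x |u x|^p < oo (nonnegative terms:
   finite partial sums over finite sets of points are uniformly bounded). *)
Definition in_lp (R : realType) (n : nat) (p : R) (u : pt n -> R) : Prop :=
  exists B : R, forall s : seq (pt n), uniq s ->
    \sum_(x <- s) (`|u x| `^ p) <= B.

Definition in_linfty (R : realType) (n : nat) (u : pt n -> R) : Prop :=
  exists B : R, forall x : pt n, `|u x| <= B.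

Definition cs_solution (R : realType) (n M : nat) (lam : R)
    (p : 'I_M -> pt n) (nn : 'I_M -> nat) (u : pt n -> R) : Prop :=
  (forall x : pt n,
     lap u x = lam * expR (u x) * (expR (u x) - 1)
               + 4 * pi * \sum_(j < M) ((nn j)%:R * delta R (p j) x))
  /\ vanishes_at_infty u.

(* Main.v *)
Require Import Defs.
From HB Require Import structures.
From mathcomp Require Import all_boot all_order all_algebra.
From mathcomp Require Import all_classical all_reals all_analysis.
From mathcomp Require Import ring lra zify.
Set Implicit Arguments. Unset Strict Implicit. Unset Printing Implicit Defensive.
Import Order.TTheory GRing.Theory Num.Theory.
Import numFieldNormedType.Exports.
Local Open Scope ring_scope.

(* Perron's method: [u] is the pointwise supremum of all nonpositive
   subsolutions.  On a lattice the equation at [x] only involves [u x] and the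
   sum over the neighbours, so continuity of the nonlinearity suffices for [u]
   to be a solution: a supremum of subsolutions is a subsolution, and where the
   inequality is strict [u] could be raised at that single point.  The maximum
   principle makes every solution nonpositive, hence [u] is maximal.

   That [u] vanishes at infinity needs one subsolution [-w] doing so.  The
   function [L x = ln (|x|^2 + 36 n)] is strictly subharmonic when [n >= 2], and
   its increments tend to [0] at infinity.  Take [w = Phi (A - C * L)], where
   [Phi t = 1 + t] for [t >= 0] and [Phi t = exp t] for [t < 0]: near the vortices
   [w] is affine in [L], and [C] large beats the point masses; far away the
   convexity of [Phi] costs at most a small multiple of [w], which the absorption
   term pays for once [A] is large.

   For the decay, [w = - u] satisfies [lap w >= lam (1 - eps) w] far from the
   vortices, so [w] shrinks by the factor [1 + lam (1 - eps) / (2 n)] at each step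
   towards infinity, and Bernoulli's inequality bounds this factor below by
   [exp (m (1 - eps))].  Summability in every [l^q] follows. *)

(** * The lattice Laplacian through neighbour sums *)

Definition nbr_sum (R : realType) (n : nat) (u : pt n -> R) (x : pt n) : R :=
  \sum_(i < n) (u (Defs.shift x i 1) + u (Defs.shift x i (-1))).

Lemma lapE (R : realType) n (u : pt n -> R) x :
  lap u x = nbr_sum u x - 2 * n%:R * u x.
Proof.
have -> : 2 * n%:R * u x = \sum_(i < n) (u x + u x).
  by rewrite sumr_const card_ord -[RHS]mulr_natl; ring.
by rewrite /lap /nbr_sum -sumrB; apply: eq_bigr => i _; ring.
Qed.

Lemma le_nbr_sum (R : realType) n (u v : pt n -> R) x :
  (forall y, u y <= v y) -> nbr_sum u x <= nbr_sum v x.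
Proof. by move=> uv; apply: ler_sum => i _; exact: lerD. Qed.

Lemma nbr_sum_const (R : realType) n (b : R) (x : pt n) :
  nbr_sum (fun=> b) x = 2 * n%:R * b.
Proof. by rewrite /nbr_sum sumr_const card_ord -[LHS]mulr_natl; ring. Qed.

Lemma nbr_sum_le (R : realType) n (u : pt n -> R) x (B : R) :
  (forall i s, `|s|%N = 1%N -> u (Defs.shift x i s) <= B) ->
  nbr_sum u x <= 2 * n%:R * B.
Proof.
move=> uB; rewrite -(nbr_sum_const B x).
by apply: ler_sum => i _; apply: lerD; exact: uB.
Qed.

Lemma shiftE n (x : pt n) i (s : int) j :
  Defs.shift x i s j = if j == i then x j + s else x j.
Proof. by rewrite ffunE. Qed.

Lemma dnorm_shift n (x : pt n) i (s : int) : `|s|%N = 1%N ->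
  (dnorm x <= (dnorm (Defs.shift x i s)).+1)%N.
Proof.
move=> s1; rewrite /dnorm (bigD1 i) //= [in X in (_ <= X)%N](bigD1 i) //=.
rewrite shiftE eqxx [in X in (_ <= X)%N](eq_bigr (fun j => `|x j|%N)); last first.
  by move=> j /negPf ji; rewrite shiftE ji.
rewrite -addSn leq_add2r.
by lia.
Qed.

(** * Finite boxes, boundedness and summation on the lattice *)

(* A point with coordinates of absolute value less than [N], encoded by signs and
   absolute values; both signs of [0] give the same point. *)
Definition box_pt n N (k : {ffun 'I_n -> bool * 'I_N}) : pt n :=
  [ffun i => (-1) ^+ (k i).1 * (k i).2%:Z].

Lemma box_pt_onto n N (x : pt n) : (dnorm x < N)%N -> exists k, x = @box_pt n N k.
Proof.
move=> xN.
have lt_i i : (`|x i| < N)%N.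
  by apply: leq_ltn_trans xN; rewrite /dnorm (bigD1 i) //= leq_addr.
exists [ffun i => (x i < 0, Ordinal (lt_i i))]; apply/ffunP => i.
by rewrite !ffunE /= -intEsign.
Qed.

Lemma absz_box_pt n N (k : {ffun 'I_n -> bool * 'I_N}) i :
  `|box_pt k i|%N = (k i).2.
Proof. by rewrite ffunE abszMsign. Qed.

Lemma vanishes_bounded (R : realType) n (f : pt n -> R) :
  vanishes_at_infty f -> exists B, forall x, f x <= B.
Proof.
move=> /(_ 1 ltr01)[r fr].
(* [1] bounds the values outside the ball; the sum over all codes dominates each value inside. *)
exists (1 + \sum_k `|f (@box_pt n r k)|) => x.
have S0 (P : pred _) : 0 <= \sum_(k | P k) `|f (@box_pt n r k)| by exact: sumr_ge0.
have [/fr|/box_pt_onto[k ->]] := leqP r (dnorm x).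
  by move/ltW/ler_normlW => /le_trans; apply; rewrite lerDl.
rewrite (bigD1 k) //=; have := ler_norm (f (box_pt k)); have := S0 (predC1 k) => /=.
by rewrite /= => h1 h2; apply: (le_trans h2); rewrite addrCA lerDl addr_ge0.
Qed.

(** [t] may have repetitions, as [codom box_pt] does at points with a zero coordinate; nonnegative
    terms make them harmless. *)
Lemma sum_uniq_le (R : realType) (T : eqType) (s t : seq T) (F : T -> R) :
  uniq s -> {subset s <= t} -> (forall x, 0 <= F x) ->
  \sum_(x <- s) F x <= \sum_(x <- t) F x.
Proof.
move=> us st F0; apply: (@le_trans _ _ (\sum_(x <- undup t) F x)).
  rewrite -(perm_big _ (permEl (perm_filterC (mem s) (undup t)))) big_cat /=.
  rewrite -[leLHS]addr0; apply: lerD; last exact: sumr_ge0.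
  rewrite le_eqVlt (perm_big [seq x <- undup t | x \in s]) ?eqxx //.
  apply: uniq_perm => //; first by rewrite filter_uniq ?undup_uniq.
  move=> x; rewrite mem_filter mem_undup; case xs: (x \in s) => //=.
  by rewrite (st _ xs).
elim: t {st} => [|x t IH]; first by rewrite !big_nil.
rewrite /=; case: ifP => _; last by rewrite !big_cons lerD.
by apply: (le_trans IH); rewrite big_cons lerDr.
Qed.

(** On an encoded box the summand is a product over coordinates, so the sum is the [n]-th power of a
    one-dimensional sum, in which the two signs give the factor [2]. *)
Lemma sum_geometric_le (R : realType) n (t : R) (s : seq (pt n)) :
  0 <= t -> t < 1 -> uniq s ->
  \sum_(x <- s) t ^+ dnorm x <= (2 / (1 - t)) ^+ n.
Proof.
move=> t0 t1 us; pose N := (\max_(x <- s) dnorm x).+1.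
apply: (@le_trans _ _ (\sum_(x <- codom (@box_pt n N)) t ^+ dnorm x)).
  apply: sum_uniq_le => // [x xs|x]; last exact: exprn_ge0.
  have [|k ->] := @box_pt_onto n N x; last exact: codom_f.
  by rewrite ltnS; apply: leq_bigmax_seq.
rewrite big_map big_enum /=.
under eq_bigr => k _ do rewrite /dnorm expr_sum.
under eq_bigr => k _ do under eq_bigr => i _ do rewrite absz_box_pt.
rewrite -(bigA_distr_bigA (fun (i : 'I_n) (b : bool * 'I_N) => t ^+ b.2)) /=.
rewrite prodr_const card_ord; apply: lerXn2r; rewrite ?nnegrE.
- by apply: sumr_ge0 => b _; exact: exprn_ge0.
- by rewrite divr_ge0// subr_ge0 ltW.
rewrite -(pair_bigA _ (fun (b : bool) (k : 'I_N) => t ^+ k)) /= big_bool /=.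
have -> : \sum_(k < N) t ^+ k = (1 - t ^+ N) / (1 - t).
  have S : (1 - t) * \sum_(k < N) t ^+ k = 1 - t ^+ N.
    by rewrite -(opprB t) mulNr -subrX1 opprB.
  by rewrite -S mulrAC divff ?mul1r// subr_eq0 gt_eqF.
rewrite -mulrDl ler_pM2r ?invr_gt0 ?subr_gt0//.
have := exprn_ge0 N t0; lra.
Qed.

(** * Elementary estimates for [expR] and [ln] *)

Lemma expR_le_quad (R : realType) (h : R) : h <= 2^-1 ->
  expR h <= 1 + h + 2 * h ^+ 2.
Proof.
move=> h2; have h0 : 0 < 1 - h by lra.
have e : 1 - h <= expR (- h) by exact: expR_ge1Dx.
have -> : expR h = (expR (- h))^-1 by rewrite expRN invrK.
apply: (@le_trans _ _ (1 - h)^-1); first by rewrite lef_pV2 ?posrE ?expR_gt0.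
rewrite -[leLHS]mul1r ler_pdivrMr//.
nra.
Qed.

Lemma ln1p_ge (R : realType) (a : R) : - 2^-1 <= a -> a - 2 * a ^+ 2 <= ln (1 + a).
Proof.
move=> a2; have a0 : 0 < 1 + a by lra.
rewrite -[1 + a]invrK lnV ?posrE ?invr_gt0//.
have -> : (1 + a)^-1 = 1 + (- a / (1 + a)) by field; lra.
rewrite lerNr; apply: le_trans (le_ln1Dx _) _.
  by rewrite ltr_pdivlMr//; lra.
rewrite ler_pdivrMr//; nra.
Qed.

Lemma ln1p_abs_le (R : realType) (a : R) : - 2^-1 <= a -> `|ln (1 + a)| <= 2 * `|a|.
Proof.
move=> a2; have a0 : 0 < 1 + a by lra.
have u : ln (1 + a) <= a by apply: le_ln1Dx; lra.
have l := ln1p_ge a2.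
rewrite ler_norml; have [p|p] := leP 0 a.
  have l0 : 0 <= ln (1 + a) by apply: ln_ge0; lra.
  by rewrite ger0_norm//; apply/andP; split; lra.
rewrite ltr0_norm//; apply/andP; split; last by lra.
nra.
Qed.

(** * The convex profile of the barrier *)

(* The [C^1] convex function [Phi] and its derivative. *)
Definition softramp (R : realType) (t : R) : R := if 0 <= t then 1 + t else expR t.
Definition softramp' (R : realType) (t : R) : R := if 0 <= t then 1 else expR t.

Lemma softramp_gt0 (R : realType) (t : R) : 0 < softramp t.
Proof. by rewrite /softramp; case: ifP => t0; [lra|exact: expR_gt0]. Qed.

Lemma softramp'_ge0 (R : realType) (t : R) : 0 <= softramp' t.
Proof. by rewrite /softramp'; case: ifP => t0//; exact: expR_ge0. Qed.

Lemma softramp_le_expR (R : realType) (t : R) : softramp t <= expR t.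
Proof. by rewrite /softramp; case: ifP => // _; exact: expR_ge1Dx. Qed.

Lemma softramp_le2 (R : realType) (t : R) : t <= 1 -> softramp t <= 2.
Proof.
move=> t1; rewrite /softramp; case: (leP 0 t) => t0; first lra.
have : expR t < 1 by rewrite expR_lt1.
lra.
Qed.

(** For [t > 1] the step stays in the affine range and costs nothing; for [t <= 1] the cost is
    proportional to [softramp t] itself, a form that absorption can pay for. *)
Lemma softramp_taylor (R : realType) (t h : R) : `|h| <= 2^-1 ->
  softramp (t + h) <=
    softramp t + softramp' t * h + (if t <= 1 then 2 * softramp t * h ^+ 2 else 0).
Proof.
rewrite ler_norml => /andP[h1 h2].
have hh : 0 <= h ^+ 2 by exact: sqr_ge0.
rewrite /softramp /softramp'; case: (leP 0 t) => t0.
  case: (leP 0 (t + h)) => th.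
    by case: ifP => _; nra.
  have -> : t <= 1 by lra.
  apply: (le_trans (expR_le_quad _)); first lra.
  nra.
have -> : t <= 1 by lra.
apply: (@le_trans _ _ (expR (t + h))).
  by case: ifP => // _; exact: expR_ge1Dx.
rewrite expRD -mulrA [2 * _]mulrC -mulrA -{2}[expR t]mulr1 -!mulrDr.
by rewrite ler_pM2l ?expR_gt0// [h ^+ 2 * 2]mulrC expR_le_quad.
Qed.

(** * Lower bounds for the absorption term *)

(* The absorption term -e^u (e^u - 1) at u = -w. *)
Definition absorb (R : realType) (w : R) : R := expR (- w) * (1 - expR (- w)).

Lemma one_sub_expRN_ge (R : realType) (w : R) : 0 <= w ->
  w / (1 + w) <= 1 - expR (- w).
Proof.
move=> w0; have e := expR_ge1Dx w.
rewrite expRN ler_pdivrMr; last lra.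
have : (expR w)^-1 * (1 + w) <= 1 by rewrite -ler_pdivlMl ?invr_gt0 ?expR_gt0// invrK mulr1.
lra.
Qed.

Lemma absorb_ge0 (R : realType) (w : R) : 0 <= w -> 0 <= absorb w.
Proof.
move=> w0; apply: mulr_ge0; first exact: expR_ge0.
by rewrite subr_ge0 -[leRHS]expR0 ler_expR oppr_le0.
Qed.

(** Slope close to the sharp value [1] near [0]; this determines the decay rate. *)
Lemma absorb_ge_small (R : realType) (w e : R) : 0 <= w -> w <= e / 2 -> e <= 1 ->
  (1 - e) * w <= absorb w.
Proof.
move=> w0 we e1; have h := one_sub_expRN_ge w0.
have k : 1 - w <= expR (- w) by exact: expR_ge1Dx.
apply: (@le_trans _ _ ((1 - w) * (w / (1 + w)))).
  rewrite mulrA ler_pdivlMr; last lra.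
  nra.
apply: ler_pM => //; first lra.
by rewrite divr_ge0//; lra.
Qed.

(** A crude slope, but valid on the whole range [w <= 2] that [softramp] takes on [t <= 1]. *)
Lemma absorb_ge_bounded (R : realType) (w : R) : 0 <= w -> w <= 2 ->
  expR (- 2) / 3 * w <= absorb w.
Proof.
move=> w0 w2; have h := one_sub_expRN_ge w0.
rewrite -mulrA; apply: ler_pM.
- exact: expR_ge0.
- by rewrite mulr_ge0// invr_ge0.
- by rewrite ler_expR lerN2.
apply: le_trans h; rewrite ler_pdivlMr; last lra.
nra.
Qed.

(** * Strict subharmonicity of the shifted logarithm *)

(* The shift [36 n] makes the second-order term of [lap (ln o quad)] dominate the
   Taylor remainder at every point, and keeps all relative increments of [quad]
   at most [1/2] in absolute value. *)
Definition quad (R : realType) n (x : pt n) : R :=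
  \sum_(i < n) (x i)%:~R ^+ 2 + 36 * n%:R.

Lemma sqr_unit (R : realType) (s : int) : `|s|%N = 1%N -> (s%:~R : R) ^+ 2 = 1.
Proof.
move=> s1; have [->|->] : s = 1 \/ s = -1 by lia.
  by rewrite expr1n.
by rewrite mulrN1z sqrrN expr1n.
Qed.

Lemma quad_shift (R : realType) n (x : pt n) i (s : int) : `|s|%N = 1%N ->
  quad R (Defs.shift x i s) = quad R x + (1 + 2 * s%:~R * (x i)%:~R).
Proof.
move=> s1; have ss := sqr_unit R s1.
rewrite /quad [in LHS](bigD1 i)//= [in RHS](bigD1 i)//= shiftE eqxx.
rewrite (eq_bigr (fun j => ((x j)%:~R : R) ^+ 2)); last first.
  by move=> j /negPf ji; rewrite shiftE ji.
by rewrite intrD sqrrD ss; ring.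
Qed.

Lemma quad_coord (R : realType) n (x : pt n) i :
  ((x i)%:~R : R) ^+ 2 + 36 * n%:R <= quad R x.
Proof.
rewrite /quad (bigD1 i)//= lerD2r lerDl; apply: sumr_ge0 => j _; exact: sqr_ge0.
Qed.

Lemma quad_ge36 (R : realType) n (x : pt n) : (0 < n)%N -> 36 <= quad R x.
Proof.
move=> n0; rewrite /quad; have : (1 : R) <= n%:R by rewrite ler1n.
have : 0 <= \sum_(i < n) ((x i)%:~R : R) ^+ 2 by apply: sumr_ge0 => i _; exact: sqr_ge0.
lra.
Qed.

Lemma quad_ge_dnorm (R : realType) n (x : pt n) : (dnorm x)%:R <= quad R x.
Proof.
rewrite /quad /dnorm natr_sum -[leLHS]addr0; apply: lerD; last by rewrite mulr_ge0.
apply: ler_sum => i _; rewrite natr_absz -rmorphXn ler_int /=.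
by nia.
Qed.

(** [h] is the relative increment of [quad]. Its numerator is linear in [x i] and [quad] dominates
    [x i ^+ 2], so [h ^+ 2] is of order [1 / quad], and at most [1 / 4] since [quad >= 36]. *)
Lemma log_increment (R : realType) n (x : pt n) i (s : int) : (0 < n)%N ->
  `|s|%N = 1%N ->
  let h := (1 + 2 * s%:~R * (x i)%:~R) / quad R x in
  - 2^-1 <= h /\ h ^+ 2 <= 9 / quad R x /\
  ln (quad R (Defs.shift x i s)) = ln (quad R x) + ln (1 + h).
Proof.
move=> n0 s1 h; have q36 := quad_ge36 R x n0; have qc := quad_coord R x i.
have ss := sqr_unit R s1.
have n1 : (1 : R) <= n%:R by rewrite ler1n.
have q0 : 0 < quad R x by lra.
have hq : h ^+ 2 <= 9 / quad R x.
  rewrite /h expr_div_n ler_pdivrMr ?exprn_gt0// (expr2 (quad R x)).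
  rewrite mulrA mulfVK ?gt_eqF// -mulrA.
  have yy : (s%:~R * (x i)%:~R) ^+ 2 = ((x i)%:~R : R) ^+ 2 by rewrite exprMn ss mul1r.
  move: yy qc; set y := s%:~R * _; move=> <- qc.
  have := sqr_ge0 (y - 1); have := sqr_ge0 y.
  have -> : (1 + 2 * y) ^+ 2 = 1 + 4 * y + 4 * y ^+ 2 by ring.
  have -> : (y - 1) ^+ 2 = y ^+ 2 - 2 * y + 1 by ring.
  lra.
have h14 : h ^+ 2 <= 4^-1.
  by apply: le_trans hq _; rewrite ler_pdivrMr//; lra.
have h2 : - 2^-1 <= h.
  have : `|h| <= 2^-1.
    by rewrite -ler_sqr ?nnegrE// real_normK ?num_real// exprVn (_ : 2 ^+ 2 = 4)//; ring.
  by rewrite ler_norml => /andP[].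
split=> //; split=> //.
rewrite quad_shift// -lnM ?posrE//; last lra.
by congr ln; rewrite mulrDr mulr1 [_ * h]mulrC /h mulfVK ?gt_eqF.
Qed.

Lemma sqr_log_increment_le (R : realType) n (x : pt n) i (s : int) : (0 < n)%N ->
  `|s|%N = 1%N ->
  (ln (quad R (Defs.shift x i s)) - ln (quad R x)) ^+ 2 <= 36 / quad R x.
Proof.
move=> n0 s1; have [] := log_increment R x i n0 s1.
set h := _ / _ => h2 [hq ->]; rewrite addrC addKr.
have := ln1p_abs_le h2; rewrite -ler_sqr ?nnegrE ?mulr_ge0//.
rewrite exprMn !real_normK ?num_real// => k; apply: le_trans k _.
have -> : 36 / quad R x = 2 ^+ 2 * (9 / quad R x) by ring.
by rewrite ler_pM2l// exprn_gt0.
Qed.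

(** Multiplying the factors of the two neighbours along axis [i] cancels the first-order terms and
    leaves [1 + a i]. The [a i] sum to [((2n - 4) q + 145 n) / q^2], where [2n - 4 >= 0], and the
    Taylor remainders take away only [18 n / q^2]. *)
Lemma lap_log_ge (R : realType) n (x : pt n) : (2 <= n)%N ->
  (quad R x) ^- 2 <= lap (fun y => ln (quad R y)) x.
Proof.
move=> n2; have n0 : (0 < n)%N by exact: leq_trans n2.
have q36 := quad_ge36 R x n0; set q := quad R x in q36 *.
have q0 : 0 < q by lra.
have nR : (2 : R) <= n%:R by rewrite (ler_nat R 2).
pose a i : R := (2 * q + 1 - 4 * (x i)%:~R ^+ 2) / q ^+ 2.
have step i : a i - 18 / q ^+ 2 <=
    (ln (quad R (Defs.shift x i 1)) - ln q) + (ln (quad R (Defs.shift x i (-1))) - ln q).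
  have [h1 [_ ->]] := @log_increment R n x i 1 n0 erefl.
  have [h1' [_ ->]] := @log_increment R n x i (-1) n0 erefl.
  rewrite -/q in h1 h1' *.
  rewrite ![ln q + _]addrC !addrK -lnM ?posrE; try lra.
  have -> : (1 + (1 + 2 * 1%:~R * (x i)%:~R) / q) *
            (1 + (1 + 2 * (-1)%:~R * (x i)%:~R) / q) = 1 + a i.
    by rewrite /a mulrN1z; field; rewrite gt_eqF.
  have qc : ((x i)%:~R : R) ^+ 2 + 36 * n%:R <= q by exact: quad_coord.
  have x0 : 0 <= ((x i)%:~R : R) ^+ 2 by exact: sqr_ge0.
  have q20 : 0 < q ^+ 2 by rewrite exprn_gt0.
  have au : a i <= 3 / q.
    rewrite /a ler_pdivrMr// (_ : 3 / q * q ^+ 2 = 3 * q); first lra.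
    by field; rewrite gt_eqF.
  have al : - (3 / q) <= a i.
    rewrite /a ler_pdivlMr// (_ : - (3 / q) * q ^+ 2 = - (3 * q)); first lra.
    by field; rewrite gt_eqF.
  have q3 : 3 / q <= 2^-1 by rewrite ler_pdivrMr//; lra.
  apply: le_trans (ln1p_ge _); last by lra.
  have -> : 18 / q ^+ 2 = 2 * (3 / q) ^+ 2 by field; rewrite gt_eqF.
  have : a i ^+ 2 <= (3 / q) ^+ 2.
    by rewrite -[_ ^+ 2]real_normK ?num_real// lerXn2r ?nnegrE// ?ler_norml ?al//; lra.
  lra.
rewrite /lap; apply: le_trans (ler_sum _ (fun i _ => step i)).
rewrite sumrB sumr_const card_ord -[_ *+ n]mulr_natl /a -mulr_suml.
rewrite sumrB sumr_const card_ord -[_ *+ n]mulr_natl -mulr_sumr.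
have -> : \sum_(i < n) ((x i)%:~R : R) ^+ 2 = q - 36 * n%:R by rewrite /q /quad addrK.
rewrite mulrA -mulrBl -[leLHS]mul1r ler_pM2r ?invr_gt0 ?exprn_gt0//.
have : 0 <= (n%:R - 2) * q by rewrite mulr_ge0 ?subr_ge0// ltW.
rewrite mulrBl; lra.
Qed.

(** * The barrier *)

Lemma barrier_exists (R : realType) n (lam B S0 : R) (g : pt n -> R) :
  (2 <= n)%N -> 0 < lam -> 0 <= B -> 0 <= S0 ->
  (forall x, g x <= B) -> (forall x, S0 < quad R x -> g x = 0) ->
  exists w : pt n -> R, [/\ forall x, 0 <= w x, vanishes_at_infty w &
    forall x, lap w x <= lam * absorb (w x) - g x].
Proof.
move=> n2 lam0 B0 S00 gB gS.
have n0 : (0 < n)%N by exact: leq_trans n2.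
have q36 x := quad_ge36 R x n0.
have q0 (x : pt n) : 0 < quad R x by have := q36 x; lra.
(* With this [C], [C * quad ^- 2] dominates [g]: where [g] can be positive, [quad <= S0] and
   [g <= B]. *)
pose C : R := B * S0 ^+ 2 + 1.
have BS0 : 0 <= B * S0 ^+ 2 by rewrite mulr_ge0// sqr_ge0.
have C0 : 0 < C by rewrite /C; lra.
have gC x : g x <= C * quad R x ^- 2.
  have [xS|xS] := ltP S0 (quad R x).
    by rewrite gS// mulr_ge0 ?invr_ge0 ?sqr_ge0// ltW.
  apply: (le_trans (gB x)); rewrite ler_pdivlMr ?exprn_gt0//.
  have : B * quad R x ^+ 2 <= B * S0 ^+ 2.
    by apply: ler_wpM2l => //; rewrite lerXn2r// nnegrE ltW.
  rewrite /C; lra.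
pose K : R := lam * (expR (- 2) / 3).
have K0 : 0 < K by rewrite mulr_gt0// divr_gt0// expR_gt0.
(* Beyond [S1] the three terms give, in turn: [g = 0]; steps of [t] at most [1/2]; and a convexity
   loss at most [K * w]. *)
pose S1 : R := S0 + 144 * C ^+ 2 + 144 * n%:R * C ^+ 2 / K.
have CC : 0 < C ^+ 2 by rewrite exprn_gt0.
have nC : 0 <= 144 * n%:R * C ^+ 2 / K by rewrite !mulr_ge0// ?invr_ge0 ltW.
have S10 : 0 < S1 by rewrite /S1; lra.
(* Ensures [t >= C] where [quad <= S1]. Steps of [t] are at most [C] because [quad >= 36], so the
   neighbours still have [t >= 0] and [lap w = lap t] there. *)
pose A : R := C * ln S1 + C.
pose t (x : pt n) := A - C * ln (quad R x).
pose w x := softramp (t x).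
have t_shift (x : pt n) i s : t (Defs.shift x i s) =
    t x + (- C * (ln (quad R (Defs.shift x i s)) - ln (quad R x))) by rewrite /t; ring.
have sq (x : pt n) i s : `|s|%N = 1%N ->
    (- C * (ln (quad R (Defs.shift x i s)) - ln (quad R x))) ^+ 2 <= 36 * C ^+ 2 / quad R x.
  move=> s1; rewrite exprMn sqrrN (_ : 36 * _ / _ = C ^+ 2 * (36 / quad R x)); last by ring.
  by rewrite ler_pM2l//; exact: sqr_log_increment_le.
have lapt x : lap t x = - C * lap (fun y => ln (quad R y)) x.
  by rewrite /lap mulr_sumr; apply: eq_bigr => i _; rewrite /t; ring.
have lapt_le x : lap t x <= - g x.
  by rewrite lapt mulNr lerN2; apply: (le_trans (gC x)); rewrite ler_pM2l//; exact: lap_log_ge.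
have w0 x : 0 <= w x by exact: ltW (softramp_gt0 _).
exists w; split=> //.
- move=> eps eps0; pose r := expR ((A - ln eps) / C).
  exists (Num.trunc r).+1 => x xr; rewrite ger0_norm//.
  apply: le_lt_trans (softramp_le_expR _) _; rewrite -[ltRHS]lnK ?posrE// ltr_expR.
  rewrite /t ltrBlDr -ltrBlDl mulrC -ltr_pdivrMr// -ltr_expR lnK ?posrE//.
  apply: lt_le_trans (quad_ge_dnorm R x); apply: lt_le_trans (truncnS_gt r) _.
  by rewrite ler_nat.
- move=> x; have [xS|xS] := leP (quad R x) S1.
    have tx : C <= t x.
      rewrite /t /A addrAC lerDr subr_ge0 ler_pM2l// ler_ln ?posrE//.
    have aff i s : `|s|%N = 1%N -> w (Defs.shift x i s) = 1 + t (Defs.shift x i s).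
      move=> s1; rewrite /w /softramp ifT// t_shift.
      have := sq x i s s1; set h := - C * _ => hC.
      have : `|h| <= C.
        rewrite -ler_sqr ?nnegrE ?(ltW C0)// real_normK ?num_real//.
        apply: (le_trans hC); rewrite ler_pdivrMr// mulrC ler_pM2l//.
      by rewrite ler_norml => /andP[]; lra.
    have -> : lap w x = lap t x.
      apply: eq_bigr => i _; rewrite !aff// [w x]/w /softramp ifT; first by ring.
      lra.
    apply: (le_trans (lapt_le x)); rewrite lerDr mulr_ge0 ?absorb_ge0//; exact: ltW.
  have g0 : g x = 0 by apply: gS; rewrite /S1 in xS; lra.
  have x144 : 144 * C ^+ 2 <= quad R x by rewrite /S1 in xS; lra.
  have xK : 144 * n%:R * C ^+ 2 <= K * quad R x.
    rewrite [K * _]mulrC -ler_pdivrMr//; rewrite /S1 in xS; lra.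
  rewrite g0 subr0.
  (* Second-order loss per neighbour; the first-order parts sum to
     [softramp' (t x) * lap t x <= 0]. *)
  pose e : R := if t x <= 1 then 2 * w x * (36 * C ^+ 2 / quad R x) else 0.
  have step i s : `|s|%N = 1%N -> w (Defs.shift x i s) - w x <=
      softramp' (t x) * (t (Defs.shift x i s) - t x) + e.
    move=> s1; have := sq x i s s1; rewrite /w t_shift; set h := - C * _ => hC.
    have h2 : `|h| <= 2^-1.
      rewrite -ler_sqr ?nnegrE// real_normK ?num_real//; apply: (le_trans hC).
      by rewrite ler_pdivrMr// exprVn (_ : 2 ^+ 2 = 4); [lra|ring].
    have := softramp_taylor (t x) h2; rewrite /e (_ : t x + h - t x = h); last by ring.
    have W := w0 x; rewrite /w in W *.
    case: ifP => _; last by lra.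
    by have := ler_wpM2l (mulr_ge0 (ler0n R 2) W) hC; lra.
  have : lap w x <= softramp' (t x) * lap t x + 2 * n%:R * e.
    rewrite -(nbr_sum_const e x) /lap mulr_sumr /nbr_sum -big_split /=.
    apply: ler_sum => i _; have := step i 1 erefl; have := step i (-1) erefl.
    lra.
  have : softramp' (t x) * lap t x <= 0.
    apply: mulr_ge0_le0; first exact: softramp'_ge0.
    by have := lapt_le x; rewrite g0 oppr0.
  suff : 2 * n%:R * e <= lam * absorb (w x) by lra.
  rewrite /e; case: ifP => [tx|_]; last first.
    by rewrite mulr0 mulr_ge0 ?absorb_ge0// ltW.
  have wx2 : w x <= 2 by exact: softramp_le2.
  apply: (@le_trans _ _ (K * w x)); last first.
    by rewrite /K -mulrA ler_pM2l//; exact: absorb_ge_bounded.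
  have -> : 2 * n%:R * (2 * w x * (36 * C ^+ 2 / quad R x)) =
    144 * n%:R * C ^+ 2 / quad R x * w x by ring.
  by rewrite ler_wpM2r// ler_pdivrMr.
Qed.

(** * Perron's method *)

(** Requiring [v x <= 0] bounds the family above, so that its pointwise suprema exist. *)
Definition subsolution (R : realType) n (F : pt n -> R -> R) (v : pt n -> R) : Prop :=
  (forall x, v x <= 0) /\ (forall x, F x (v x) <= lap v x).

Definition perron (R : realType) n (F : pt n -> R -> R) (x : pt n) : R :=
  sup [set v x | v in subsolution F]%classic.

Section Perron.
Variables (R : realType) (n : nat) (F : pt n -> R -> R).
Hypotheses (Fcont : forall x, continuous (F x)) (F0 : forall x, 0 <= F x 0).
Variable v0 : pt n -> R.
Hypothesis v0_sub : subsolution F v0.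

Lemma perron_ub v x : subsolution F v -> v x <= perron F x.
Proof.
move=> vs; apply: ub_le_sup; last by exists v.
by exists 0 => _ [v' [v'0 _] <-].
Qed.

Lemma perron_le0 x : perron F x <= 0.
Proof.
apply: ge_sup; first by exists (v0 x), v0.
by move=> _ [v [v0' _] <-].
Qed.

Lemma perron_adherent x e : 0 < e ->
  exists2 v, subsolution F v & perron F x - e < v x.
Proof.
move=> e0; have [|_ [v vs <-] ve] := @sup_adherent R [set v x | v in subsolution F]%classic e e0.
  split; first by exists (v0 x), v0.
  by exists 0 => _ [v' [v'0 _] <-].
by exists v.
Qed.

(** [lap u x - F x (u x)] with the neighbour sum frozen at [b]: a continuous function of the central
    value alone. *)
Let residual x (b t : R) := b - 2 * n%:R * t - F x t.

Let residual_near x b t0 : residual x b t0 != 0 ->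
  exists2 e, 0 < e & forall t, `|t0 - t| < e -> 0 < residual x b t * Num.sg (residual x b t0).
Proof.
move=> r0.
have cont : {for t0, continuous (residual x b)}.
  apply: continuousB; last exact: Fcont.
  by apply: continuousB; [exact: cst_continuous|apply: continuousM; [exact: cst_continuous|]].
have n0 : 0 < `|residual x b t0| by rewrite normr_gt0.
move: cont => /cvgrPdist_lt /(_ _ n0) /nbhs_ballP[e /= e0 he].
exists e => // t te; have := he t te; rewrite ltr_norml => /andP[].
have [r|r|r] := ltgtP (residual x b t0) 0.
- by rewrite ltr0_sg// ltr0_norm//; lra.
- by rewrite gtr0_sg// gtr0_norm//; lra.
- by rewrite r eqxx in r0.
Qed.

(** Were the residual negative at the supremum, it would stay negative at a subsolution [v] close to
    it at [x], and the neighbour sum of [v] is no larger: a contradiction. *)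
Lemma perron_sub x : F x (perron F x) <= lap (perron F) x.
Proof.
rewrite leNgt; apply/negP => h.
have r0 : residual x (nbr_sum (perron F) x) (perron F x) < 0.
  by rewrite /residual; rewrite lapE in h; lra.
have [e e0 he] := residual_near (ltr0_neq0 r0).
have [v vs ve] := perron_adherent x e0.
have : `|perron F x - v x| < e.
  by rewrite ger0_norm ?subr_ge0 ?perron_ub//; lra.
move=> /he; rewrite ltr0_sg// mulrN1 oppr_gt0 /residual.
have := le_nbr_sum x (fun y => perron_ub y vs).
by case: vs => _ /(_ x); rewrite lapE; lra.
Qed.

Lemma perron_super x : lap (perron F) x <= F x (perron F x).
Proof.
rewrite leNgt; apply/negP => h.
set u := perron F in h *.
have nonpos : nbr_sum u x <= 0.
  have := @nbr_sum_le R n u x 0 (fun i s _ => perron_le0 _); lra.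
have r0 : 0 < residual x (nbr_sum u x) (u x).
  by rewrite /residual; rewrite lapE in h; lra.
(* There is room to raise: at [u x = 0] the residual would be [nbr_sum u x - F x 0], which is not
   positive. *)
have ux : u x < 0.
  rewrite lt_neqAle perron_le0 andbT; apply/eqP => u0.
  by move: r0; rewrite /residual u0; have := F0 x; lra.
have [e e0 he] := residual_near (lt0r_neq0 r0).
(* Small enough to keep the residual positive and the raised value nonpositive. *)
pose d := Num.min (e / 2) (- u x).
have d0 : 0 < d by rewrite lt_min; apply/andP; split; lra.
have de : d <= e / 2 by rewrite ge_min lexx.
have du : d <= - u x by rewrite ge_min lexx orbT.
pose u' y := if y == x then u x + d else u y.
have uu' y : u y <= u' y by rewrite /u'; case: eqP => // ->; lra.
have u'x : u' x = u x + d by rewrite /u' eqxx.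
suff /(perron_ub x) : subsolution F u' by rewrite u'x -/u; lra.
split=> y.
  by rewrite /u'; case: eqP => _; [lra|exact: perron_le0].
have nn := le_nbr_sum y uu'.
(* At other points, raising [u x] can only increase the neighbour sum. *)
have [yx|yx] := eqVneq y x; last first.
  have := perron_sub y; rewrite -/u !lapE (_ : u' y = u y); first by lra.
  by rewrite /u' (negPf yx).
have : `|u x - u' x| < e by rewrite u'x opprD addNKr normrN gtr0_norm//; lra.
move=> /he; rewrite gtr0_sg// mulr1 /residual -yx lapE in nn *.
by rewrite yx in nn *; lra.
Qed.

End Perron.

(** * Maximum principle and decay at infinity *)

(** Every value is at most [2n m / (2n + lam)] with [m] the supremum, hence so is [m], which is
    absurd for [m > 0]. *)
Lemma max_principle (R : realType) n (lam : R) (f : pt n -> R) :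
  0 < lam -> vanishes_at_infty f ->
  (forall x, 0 < f x -> lam * f x <= lap f x) -> forall x, f x <= 0.
Proof.
move=> lam0 /vanishes_bounded[B fB] fsub x0; rewrite leNgt; apply/negP => fx0.
pose E := range f; pose m := sup E.
have Eub : has_ubound E by exists B => _ [x _ <-].
have fm x : f x <= m by apply: ub_le_sup => //; exists x.
have m0 : 0 < m by exact: lt_le_trans (fm x0).
have N0 : 0 <= 2 * n%:R :> R by rewrite mulr_ge0.
have : m <= 2 * n%:R * m / (2 * n%:R + lam).
  apply: ge_sup; first by exists (f x0), x0.
  move=> _ [x _ <-]; rewrite ler_pdivlMr; last by lra.
  have [fx|fx] := leP (f x) 0.
    have : f x * (2 * n%:R + lam) <= 0 by apply: mulr_le0_ge0 => //; lra.
    have : 0 <= 2 * n%:R * m by rewrite mulr_ge0// ltW.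
    lra.
  have := fsub x fx; rewrite lapE.
  have := @nbr_sum_le R n f x m (fun i s _ => fm _); lra.
rewrite ler_pdivlMr; last by lra.
have : 0 < m * lam by rewrite mulr_gt0.
lra.
Qed.

(* Each step towards infinity gains the factor [2n / (2n + c)]. *)
Lemma geometric_decay (R : realType) n (c B : R) r (w : pt n -> R) :
  (0 < n)%N -> 0 < c -> (forall x, w x <= B) ->
  (forall x, (r <= dnorm x)%N -> c * w x <= lap w x) ->
  forall k x, (r + k <= dnorm x)%N -> w x <= B * (1 + c / (2 * n%:R)) ^- k.
Proof.
move=> n0 c0 wB wsub; have N0 : 0 < 2 * n%:R :> R by rewrite mulr_gt0// ltr0n.
have q0 : 0 < 1 + c / (2 * n%:R) by rewrite addr_gt0// divr_gt0.
elim=> [|k IH] x xr; first by rewrite expr0 invr1 mulr1.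
have nb : nbr_sum w x <= 2 * n%:R * (B * (1 + c / (2 * n%:R)) ^- k).
  apply: nbr_sum_le => i s s1; apply: IH; have := dnorm_shift x i s1; lia.
have : c * w x <= lap w x by apply: wsub; lia.
have -> : B * (1 + c / (2 * n%:R)) ^- k.+1 =
    B * (1 + c / (2 * n%:R)) ^- k / (1 + c / (2 * n%:R)) by rewrite exprS invfM mulrA mulrAC.
rewrite lapE => h; rewrite ler_pdivlMr// -(ler_pM2l N0).
have -> : 2 * n%:R * (w x * (1 + c / (2 * n%:R))) = 2 * n%:R * w x + c * w x.
  by field; rewrite pnatr_eq0 -lt0n.
lra.
Qed.

(** Concavity of [ln] at [y], the convex combination of [1] and [1 + c] with weights [e] and
    [1 - e]: the tangent at [y] lies above [ln] at both points. *)
Lemma bernoulli_expR (R : realType) (e c : R) : 0 < e < 1 -> 0 < c ->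
  expR (ln (1 + c) * (1 - e)) <= 1 + (1 - e) * c.
Proof.
move=> /andP[e0 e1] c0; have c1 : 0 < 1 + c by lra.
pose y := 1 + (1 - e) * c; have ec : 0 <= (1 - e) * c by rewrite mulr_ge0; lra.
have y0 : 0 < y by rewrite /y; lra.
rewrite -[leRHS]lnK ?posrE// ler_expR.
have tangent z : 0 < z -> ln z <= ln y + (z / y - 1).
  move=> z0; have -> : z = y * (1 + (z / y - 1)) by field; rewrite gt_eqF.
  have zy : 0 < z / y by rewrite divr_gt0.
  rewrite lnM ?posrE//; last lra.
  rewrite lerD2l (_ : y * (1 + _) / y = z / y); last by field; rewrite gt_eqF.
  by apply: le_ln1Dx; lra.
have h1 := tangent _ c1; have := tangent 1 ltr01; rewrite ln1 => h0.
have k1 : 0 <= (1 - e) * (ln y + ((1 + c) / y - 1) - ln (1 + c)).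
  by rewrite mulr_ge0; lra.
have k0 : 0 <= e * (ln y + (1 / y - 1)) by rewrite mulr_ge0; lra.
have : (1 - e) * ((1 + c) / y - 1) + e * (1 / y - 1) = 0.
  by rewrite /y; field; rewrite gt_eqF.
lra.
Qed.

Lemma exp_decay_in_lp (R : realType) n (u : pt n -> R) (C a q : R) :
  0 < a -> 0 <= C -> 1 <= q ->
  (forall x, `|u x| <= C * expR (- a) ^+ dnorm x) -> in_lp q u.
Proof.
move=> a0 C0 q1 ub; have q0 : 0 <= q by lra.
exists (C `^ q * (2 / (1 - expR (- a))) ^+ n) => s us.
have t0 := expR_gt0 (- a); have t1 : expR (- a) < 1 by rewrite expR_lt1 oppr_lt0.
apply: (@le_trans _ _ (C `^ q * \sum_(x <- s) expR (- a) ^+ dnorm x)); last first.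
  by rewrite ler_wpM2l ?powR_ge0// sum_geometric_le// ltW.
rewrite mulr_sumr; apply: ler_sum => x _.
have tx0 : 0 < expR (- a) ^+ dnorm x by rewrite exprn_gt0.
apply: (@le_trans _ _ ((C * expR (- a) ^+ dnorm x) `^ q)).
  by apply: ge0_ler_powR; rewrite ?nnegrE ?mulr_ge0// ltW.
rewrite (powRM q C0 (ltW tx0)).
(* A base in [(0, 1]] does not grow when raised to [q >= 1], so the plain geometric sum suffices. *)
rewrite ler_wpM2l ?powR_ge0// -[leRHS](powRr1 (ltW tx0)).
by apply: ger_powR => //; rewrite tx0 exprn_ile1// ltW.
Qed.

Lemma lapN (R : realType) n (u : pt n -> R) x : lap (fun y => - u y) x = - lap u x.
Proof. by rewrite /lap -sumrN; apply: eq_bigr => i _; ring. Qed.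

Lemma absorb_decay (R : realType) n (lam eps : R) r (w : pt n -> R) :
  (0 < n)%N -> 0 < lam -> 0 < eps < 1 ->
  (forall x, 0 <= w x) -> vanishes_at_infty w ->
  (forall x, (r <= dnorm x)%N -> lap w x = lam * absorb (w x)) ->
  exists2 C, 0 <= C & forall x,
    w x <= C * expR (- (ln (1 + lam / (2 * n%:R)) * (1 - eps))) ^+ dnorm x.
Proof.
move=> n0 lam0 e01 w0 wv weq; have /andP[e0 e1] := e01.
have N0 : 0 < 2 * n%:R :> R by rewrite mulr_gt0// ltr0n.
have [B0 wB0] := vanishes_bounded wv; pose B := Num.max 0 B0.
have wB x : w x <= B by rewrite le_max wB0 orbT.
have B_ge0 : 0 <= B by rewrite le_max lexx.
(* The threshold under which [absorb_ge_small] gives slope [1 - eps]. *)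
have [r1 wr1] := wv (eps / 2) (divr_gt0 e0 (ltr0n _ 2)).
pose r2 := maxn r r1; pose c := (1 - eps) * lam.
have c0 : 0 < c by rewrite mulr_gt0// subr_gt0.
have wsub x : (r2 <= dnorm x)%N -> c * w x <= lap w x.
  rewrite geq_max => /andP[rx r1x]; rewrite weq// /c mulrAC mulrC ler_pM2l//.
  apply: absorb_ge_small => //; last exact: ltW.
  by have := wr1 x r1x; rewrite ger0_norm// => /ltW.
have decay := geometric_decay n0 c0 wB wsub.
set a := ln _ * _; set q := 1 + c / _ in decay.
have aq : expR a <= q.
  rewrite /q /c -mulrA; apply: bernoulli_expR => //; exact: divr_gt0.
have a0 : 0 <= a.
  rewrite mulr_ge0 ?subr_ge0 ?(ltW e1)// ln_ge0// lerDl ltW//; exact: divr_gt0.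
have E0 := expR_gt0 a; have E1 : 1 <= expR a by rewrite -expR0 ler_expR.
(* The factor [expR a ^+ r2] makes up for decay starting only at distance [r2], and lets the bound
   [B] cover the ball inside. *)
exists (B * expR a ^+ r2) => [|x]; first by rewrite mulr_ge0// exprn_ge0// ltW.
rewrite expRN exprVn -mulrA; have [rx|rx] := leqP r2 (dnorm x).
  have := decay (dnorm x - r2)%N x; rewrite subnKC// => /(_ (leqnn _)) /le_trans; apply.
  rewrite ler_wpM2l//.
  rewrite -[in leRHS](subnKC rx) exprD invfM mulrA divff ?mul1r ?gt_eqF ?exprn_gt0//.
  have q0 : 0 < q by exact: lt_le_trans aq.
  by rewrite lef_pV2 ?posrE ?exprn_gt0// lerXn2r// nnegrE ltW.
apply: (le_trans (wB x)); rewrite ler_peMr//.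
by rewrite ler_pdivlMr ?exprn_gt0// mul1r ler_weXn2l// ltnW.
Qed.

(** * The vortex equation: existence, maximality, summability and decay *)

Theorem theorem1p1 (R : realType) (n M : nat) (lam : R)
    (p : 'I_M -> pt n) (nn : 'I_M -> nat) :
  (2 <= n)%N -> 0 < lam -> injective p -> (forall j, (0 < nn j)%N) ->
  exists u : pt n -> R,
    cs_solution lam p nn u
    /\ (forall q : R, 1 <= q -> in_lp q u)
    /\ in_linfty u
    /\ (forall f : pt n -> R, cs_solution lam p nn f -> forall x, f x <= u x)
    /\ (forall eps : R, 0 < eps < 1 ->
          exists C : R, exists r : nat, forall x : pt n, (r <= dnorm x)%N ->
            `|u x| <= C * expR (- (ln (1 + lam / (2 * n%:R)) * (1 - eps)
                                    * (dnorm x)%:R))).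
Proof.
move=> n2 lam0 _ _; have n0 : (0 < n)%N by exact: leq_trans n2.
pose g x : R := 4 * pi * \sum_(j < M) ((nn j)%:R * delta R (p j) x).
have pi0 : 0 <= 4 * pi :> R by rewrite mulr_ge0// pi_ge0.
have delta01 (a x : pt n) : 0 <= delta R a x <= 1.
  by rewrite /delta; case: eqP => _; rewrite ?lexx ler01.
have g0 x : 0 <= g x.
  rewrite mulr_ge0//; apply: sumr_ge0 => j _; rewrite mulr_ge0//.
  by have /andP[] := delta01 (p j) x.
have g_far x : (forall j, x != p j) -> g x = 0.
  by move=> xp; rewrite /g big1 ?mulr0// => j _; rewrite /delta (negPf (xp j)) mulr0.
(* The bound on [g] is the total mass of the sources; the sum of [quad] over the vortices is at
   least its value at each one, so [g] vanishes beyond it. *)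
have [||||w [w0 wv wsup]] := @barrier_exists R n lam
    (4 * pi * \sum_(j < M) (nn j)%:R) (\sum_(j < M) quad R (p j)) g n2 lam0.
- by rewrite mulr_ge0// sumr_ge0.
- by apply: sumr_ge0 => j _; have := quad_ge36 R (p j) n0; lra.
- move=> x; rewrite ler_wpM2l//; apply: ler_sum => j _.
  by rewrite ler_piMr//; have /andP[] := delta01 (p j) x.
- move=> x xS; apply: g_far => j; apply: contraTneq xS => ->.
  rewrite -leNgt (bigD1 j)//= lerDl; apply: sumr_ge0 => i _.
  by have := quad_ge36 R (p i) n0; lra.
pose F (x : pt n) (t : R) := lam * expR t * (expR t - 1) + g x.
have FN x t : F x (- t) = g x - lam * absorb t by rewrite /F /absorb; ring.
have Fcont x : continuous (F x).
  move=> t; have : {for t, continuous (fun s : R => lam * expR s * (expR s - 1) + g x)}; last by [].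
  apply: continuousD; last exact: cst_continuous.
  apply: continuousM.
    by apply: continuousM; [exact: cst_continuous|exact: continuous_expR].
  by apply: continuousB; [exact: continuous_expR|exact: cst_continuous].
have F0 x : 0 <= F x 0 by rewrite /F expR0 subrr mulr0 add0r.
have wsubsol : subsolution F (fun x => - w x).
  split=> x; first by rewrite oppr_le0.
  by rewrite FN lapN; have := wsup x; lra.
pose u := perron F.
have u0 x : u x <= 0 := perron_le0 wsubsol x.
have wu x : - u x <= w x by rewrite lerNl; exact: (perron_ub x wsubsol).
have ueq x : lap u x = F x (u x).
  apply/eqP; rewrite eq_le; apply/andP; split.
    exact: (perron_super Fcont F0 wsubsol).
  exact: (perron_sub Fcont wsubsol).
have nu0 x : 0 <= - u x by rewrite oppr_ge0.
have normu x : `|u x| = - u x by rewrite ler0_norm.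
have uv : vanishes_at_infty u.
  move=> eps /wv[r wr]; exists r => x /wr; rewrite normu ger0_norm//.
  exact: le_lt_trans.
have nuv : vanishes_at_infty (fun x => - u x).
  by move=> eps /uv[r ur]; exists r => x /ur; rewrite normrN.
have decay eps : 0 < eps < 1 -> exists2 C, 0 <= C & forall x,
    `|u x| <= C * expR (- (ln (1 + lam / (2 * n%:R)) * (1 - eps))) ^+ dnorm x.
  move=> e01.
  have [|C C0 uC] := @absorb_decay R n lam eps (\max_(j < M) dnorm (p j)).+1
      (fun x => - u x) n0 lam0 e01 nu0 nuv.
    move=> x xr; rewrite lapN ueq -[u x in LHS]opprK FN g_far; first by ring.
    move=> j; apply: contraTneq xr => ->; rewrite -ltnNge ltnS.
    exact: (@leq_bigmax _ (fun k => dnorm (p k)) j).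
  by exists C => // x; rewrite normu.
exists u; split; first by split.
split; [|split; [|split]].
(* Any positive exponential rate gives summability; [eps = 1/2] provides one. *)
- move=> q q1; have [|C C0 uC] := decay 2^-1; first by apply/andP; split; lra.
  apply: exp_decay_in_lp C0 q1 uC; rewrite mulr_gt0//; last lra.
  by rewrite ln_gt0// ltrDl divr_gt0// mulr_gt0// ltr0n.
- have [B wB] := vanishes_bounded nuv.
  by exists B => x; rewrite normu.
- move=> f [feq fv] x; apply: perron_ub.
  (* Where [f y > 0], both [expR (f y) >= 1] and [expR (f y) - 1 >= f y], so [lap f y >= lam * f y].
     Being nonpositive, [f] then belongs to Perron's family. *)
  have f0 : forall x, f x <= 0.
    apply: (max_principle lam0 fv) => y fy; rewrite feq.
    apply: ler_wpDr; first exact: g0.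
    rewrite -mulrA ler_pM2l//; have := expR_ge1Dx (f y) => h.
    by apply: (@le_trans _ _ (expR (f y) - 1)); [lra|rewrite ler_peMl//; lra].
  by split=> // y; rewrite feq.
- move=> eps /decay[C _ uC]; exists C, 0%N => x _; apply: (le_trans (uC x)).
  by rewrite -expRM_natr mulNr.
Qed.
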